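(* Let $(\mathfrak g,[\cdot,\cdot]_{\mathfrak g})$ and $(\mathfrak h,[\cdot,\cdot]_{\mathfrak h})$ be Leibniz algebras and $(\mathfrak h,\rho^L,\rho^R)$ a Leibniz $\mathfrak g$-representation. A linear map $H:\mathfrak g\to\mathfrak h$ is a crossed homomorphism from $\mathfrak g$ to $\mathfrak h$ if and only if $H\in C^1(\mathfrak g,\mathfrak h)$ is a Maurer-Cartan element of the differential graded Lie algebra $\big(\bigoplus_{n}\mathrm{Hom}(\mathfrak g^{\otimes n},\mathfrak h),\widehat{[\![\ ,\ ]\!]},d\big)$, i.e. $dH+\tfrac12\widehat{[\![H,H]\!]}=0$.
   Context: All vector spaces are over a field $\mathbf k$ of characteristic $0$. A Leibniz algebra is a vector space $\mathfrak g$ with a bilinear bracket satisfying $[x,[y,z]_{\mathfrak g}]_{\mathfrak g}=[[x,y]_{\mathfrak g},z]_{\mathfrak g}+[y,[x,z]_{\mathfrak g}]_{\mathfrak g}$ for all $x,y,z$. A representation of $\mathfrak g$ is a vector space $V$ with linear maps $\rho^L,\rho^R:\mathfrak g\to \mathrm{End}(V)$ such that for all $x,y\in\mathfrak g$: $\rho^L([x,y]_{\mathfrak g})=\rho^L(x)\rho^L(y)-\rho^L(y)\rho^L(x)$; $\rho^R([x,y]_{\mathfrak g})=\rho^L(x)\rho^R(y)-\rho^R(y)\rho^L(x)$; $\rho^R([x,y]_{\mathfrak g})=\rho^L(x)\rho^R(y)+\rho^R(y)\rho^R(x)$. A Leibniz $\mathfrak g$-representation is a Leibniz algebra $\mathfrak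 h$ with linear maps $\rho^L,\rho^R:\mathfrak g\to\mathrm{End}(\mathfrak h)$ making $(\mathfrak h,\rho^L,\rho^R)$ a representation of $\mathfrak g$ and such that for all $h,k\in\mathfrak h$, $x\in\mathfrak g$: $\rho^L(x)[h,k]_{\mathfrak h}=[\rho^L(x)h,k]_{\mathfrak h}+[h,\rho^L(x)k]_{\mathfrak h}$; $[h,\rho^R(x)k]_{\mathfrak h}=\rho^R(x)[h,k]_{\mathfrak h}+[k,\rho^R(x)h]_{\mathfrak h}$; $[h,\rho^L(x)k]_{\mathfrak h}=[\rho^R(x)h,k]_{\mathfrak h}+\rho^L(x)[h,k]_{\mathfrak h}$. A crossed homomorphism is a linear map $H:\mathfrak g\to\mathfrak h$ with $H([x,y]_{\mathfrak g})=\rho^L(x)H(y)+\rho^R(y)H(x)+[H(x),H(y)]_{\mathfrak h}$ for all $x,y\in\mathfrak g$. Balavoine bracket. For a vector space $E$, $P\in\mathrm{Hom}(E^{\otimes p+1},E)$ and $Q\in\mathrm{Hom}(E^{\otimes q+1},E)$ with $p,q\ge 0$ (so $P$ has degree $p$ and $Q$ degree $q$), set $[\![P,Q]\!]=P\,\overline{\diamond}\,Q-(-1)^{pq}Q\,\overline{\diamond}\,P$, where $P\,\overline\diamond\, Q=\sum_{k=1}^{p+1}(-1)^{(k-1)q}P\diamond_kQ$ and $$P\diamond_kQ(x_1,\dots,x_{p+q+1})=\sum_{\sigma}(-1)^\sigma P(x_{\sigma(1)},\dots,x_{\sigma(k-1)},Q(x_{\sigma(k)},\dots,x_{\sigma(k+q-1)},x_{k+q}),x_{k+q+1},\dots,x_{p+q+1}),$$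 the sum being over $(k-1,q)$-shuffles $\sigma$. This is a graded Lie bracket. The dgLa. Take $E=\mathfrak g\oplus\mathfrak h$ and regard multilinear maps among $\mathfrak g$ and $\mathfrak h$ as maps on $E$, extended by zero. Let $\mu_{\mathfrak g},\mu_{\mathfrak h}$ be the Leibniz brackets of $\mathfrak g,\mathfrak h$ and let $\rho^L+\rho^R$ denote the bilinear map $((x,h),(y,k))\mapsto(0,\rho^L(x)k+\rho^R(y)h)$. Put $C^n(\mathfrak g,\mathfrak h)=\mathrm{Hom}(\mathfrak g^{\otimes n},\mathfrak h)$, placed in degree $n$ ($n\ge1$). For $f\in C^m(\mathfrak g,\mathfrak h)$ and $g\in C^n(\mathfrak g,\mathfrak h)$ define $$\widehat{[\![f,g]\!]}=(-1)^{m-1}[\![[\![\mu_{\mathfrak h},f]\!],g]\!],\qquad d f=[\![\mu_{\mathfrak g}+\rho^L+\rho^R,f]\!].$$ Explicitly, for $f\in C^n(\mathfrak g,\mathfrak h)$, $$(df)(x_1,\dots,x_{n+1})=(-1)^{n+1}\sum_{i=1}^n(-1)^{i+1}\rho^L(x_i)f(x_1,\dots,\hat x_i,\dots,x_{n+1})+\rho^R(x_{n+1})f(x_1,\dots,x_n)$$ $$+(-1)^{n+1}\sum_{1\le i<j\le n+1}(-1)^if(x_1,\dots,\hat x_i,\dots,x_{j-1},[x_i,x_j]_{\mathfrak g},x_{j+1},\dots,x_{n+1}).$$ With these, $(\bigoplus_nC^n(\mathfrak g,\mathfrak h),\widehat{[\![\ ,\ ]\!]},d)$ is a differential graded Lie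 algebra. *)

(* Defs.v *)
From HB Require Import structures.
From mathcomp Require Import all_boot all_order all_fingroup all_algebra.
From mathcomp Require Import sesquilinear.
From mathcomp Require Import boolp functions.
From mathcomp Require Import zify.

Set Implicit Arguments.
Unset Strict Implicit.
Unset Printing Implicit Defensive.

Import GRing.Theory.
Local Open Scope ring_scope.

HB.mixin Record Lmodule_isLeibniz (K : fieldType) L of GRing.Lmodule K L := {
  lbracket : {bilinear L -> L -> L};
  lbracketA : forall x y z : L,
    lbracket x (lbracket y z) =
    lbracket (lbracket x y) z + lbracket y (lbracket x z) }.

#[short(type="leibnizType")]
HB.structure Definition Leibniz (K : fieldType) :=
  {L of GRing.Lmodule K L & Lmodule_isLeibniz K L}.

(* A linear map rho : g -> End(V) is encoded as the bilinear map              *)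
(* (x, v) |-> rho(x) v.                                                       *)
Record representation (K : fieldType) (g : leibnizType K) (V : lmodType K) := {
  rhoL : {bilinear g -> V -> V};
  rhoR : {bilinear g -> V -> V};
  rhoL_bracket : forall (x y : g) (v : V),
    rhoL (lbracket x y) v = rhoL x (rhoL y v) - rhoL y (rhoL x v);
  rhoR_bracket : forall (x y : g) (v : V),
    rhoR (lbracket x y) v = rhoL x (rhoR y v) - rhoR y (rhoL x v);
  rhoR_bracketD : forall (x y : g) (v : V),
    rhoR (lbracket x y) v = rhoL x (rhoR y v) + rhoR y (rhoR x v) }.

Record leibniz_representation (K : fieldType) (g h : leibnizType K) := {
  leibniz_rep :> representation g h;
  rhoL_deriv : forall (x : g) (u v : h),
    rhoL leibniz_rep x (lbracket u v) =
    lbracket (rhoL leibniz_rep x u) v + lbracket u (rhoL leibniz_rep x v);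
  lbracket_rhoR : forall (x : g) (u v : h),
    lbracket u (rhoR leibniz_rep x v) =
    rhoR leibniz_rep x (lbracket u v) + lbracket v (rhoR leibniz_rep x u);
  lbracket_rhoL : forall (x : g) (u v : h),
    lbracket u (rhoL leibniz_rep x v) =
    lbracket (rhoR leibniz_rep x u) v + rhoL leibniz_rep x (lbracket u v) }.

Definition crossed_homomorphism (K : fieldType) (g h : leibnizType K)
    (rho : leibniz_representation g h) (H : {linear g -> h}) : Prop :=
  forall x y : g,
    H (lbracket x y) = rhoL rho x (H y) + rhoR rho y (H x) + lbracket (H x) (H y).

(* [multilin n U V] stands for Hom(U^{(x) n}, V): multilinear maps in n        *)
(* arguments, with the pointwise vector space structure.                      *)
Section Multilinear.
Variables (K : fieldType) (n : nat) (U V : lmodType K).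

Definition multilinear (f : ('I_n -> U) -> V) : Prop :=
  forall (x : 'I_n -> U) (i : 'I_n) (a : K) (u v : U),
    f (dfwith x (i := i) (a *: u + v)) =
    a *: f (dfwith x (i := i) u) + f (dfwith x (i := i) v).

Definition multilinear_pred : {pred ('I_n -> U) -> V} :=
  fun f => `[< multilinear f >].

Record multilin := Multilin {
  multilin_fun :> ('I_n -> U) -> V;
  _ : multilin_fun \in multilinear_pred }.

HB.instance Definition _ := [isSub for multilin_fun].
HB.instance Definition _ := [Choice of multilin by <:].

Lemma multilinear_submod : submod_closed multilinear_pred.
Proof.
split=> [|a f g /asboolP fP /asboolP gP]; apply/asboolP => x i b u v.
  by rewrite /= scaler0 addr0.
rewrite !fctE /= fP gP !scalerDr !scalerA -!addrA; congr (_ + _).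
  by rewrite mulrC.
by rewrite addrCA.
Qed.

HB.instance Definition _ :=
  GRing.isSubmodClosed.Build _ _ multilinear_pred multilinear_submod.
HB.instance Definition _ := [SubChoice_isSubLmodule of multilin by <:].

Lemma multilinP (f : multilin) : multilinear f.
Proof. by case: f => f /= /asboolP. Qed.

Definition to_multilin (f : ('I_n -> U) -> V) (fP : multilinear f) : multilin :=
  Multilin (asboolT fP).

Lemma multilinDE (f f' : multilin) (x : 'I_n -> U) : (f + f') x = f x + f' x.
Proof. by []. Qed.

Lemma multilinZE (a : K) (f : multilin) (x : 'I_n -> U) : (a *: f) x = a *: f x.
Proof. by []. Qed.

Lemma multilin_sumE (I : Type) (r : seq I) (P : pred I) (F : I -> multilin)
    (x : 'I_n -> U) :
  (\sum_(i <- r | P i) F i) x = \sum_(i <- r | P i) F i x.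
Proof. by elim/big_ind2: _ => // f1 y1 f2 y2 <- <-. Qed.

Lemma multilin_eq0 (f : multilin) (x : 'I_n -> U) (i : 'I_n) :
  x i = 0 -> f x = 0.
Proof.
move=> xi0; have E : x = dfwith x (i := i) 0.
  apply/funext => j; case: (eqVneq i j) => [<-|ij]; rewrite ?dfwith_in //.
  by rewrite dfwith_out.
have := multilinP f x i 0 0 0; rewrite scaler0 addr0 -E scale0r add0r => _.
have := multilinP f x i (-1) 0 0.
by rewrite scaler0 addr0 -E scaleN1r addNr.
Qed.

End Multilinear.

Section MultilinearConstructions.
Variable K : fieldType.

Lemma multilin_lin_subproof (U V : lmodType K) (H : {linear U -> V}) :
  multilinear (fun x : 'I_1 -> U => H (x ord0)).
Proof. by move=> x i a u v; rewrite (ord1 i) !dfwith_in linearP. Qed.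

Definition multilin_lin (U V : lmodType K) (H : {linear U -> V}) :
  multilin 1 U V := to_multilin (multilin_lin_subproof H).

Lemma multilin_bilin_subproof (U V : lmodType K) (b : {bilinear U -> U -> V}) :
  multilinear (fun x : 'I_2 -> U => b (x ord0) (x ord_max)).
Proof.
move=> x i a u v; case: (eqVneq i ord0) => [->|i0].
  by rewrite !dfwith_in !dfwith_out // linearPl.
have -> : i = ord_max by apply/val_inj; case: i i0 => [[|[|]]].
by rewrite !dfwith_in !dfwith_out // linearPr.
Qed.

Definition multilin_bilin (U V : lmodType K) (b : {bilinear U -> U -> V}) :
  multilin 2 U V := to_multilin (multilin_bilin_subproof b).

Lemma multilin_reindex_subproof (m n : nat) (U V : lmodType K)
    (e : 'I_m -> 'I_n) (bij_e : bijective e) (f : multilin m U V) :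
  multilinear (fun x : 'I_n -> U => f (x \o e)).
Proof.
case: bij_e => e' eK e'K x i a u v.
have E w : dfwith x (i := i) w \o e = dfwith (x \o e) (i := e' i) w.
  apply/funext => j /=; case: (eqVneq (e' i) j) => [<-|ij].
    by rewrite dfwith_in e'K dfwith_in.
  rewrite !dfwith_out //; apply: contra ij => /eqP ->; by rewrite eK.
by rewrite !E multilinP.
Qed.

Definition multilin_reindex (m n : nat) (U V : lmodType K)
    (e : 'I_m -> 'I_n) (bij_e : bijective e) (f : multilin m U V) :
  multilin n U V := to_multilin (multilin_reindex_subproof bij_e f).

Lemma cast_ord_bij (m n : nat) (eq_mn : m = n) : bijective (cast_ord eq_mn).
Proof. exact: Bijective (cast_ordK eq_mn) (cast_ordKV eq_mn). Qed.

Definition multilin_cast (m n : nat) (U V : lmodType K) (eq_mn : m = n) :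
  multilin m U V -> multilin n U V := multilin_reindex (cast_ord_bij eq_mn).

Lemma perm_bij (n : nat) (s : 'S_n) : bijective s.
Proof. exact: injF_bij perm_inj. Qed.

Definition multilin_perm (n : nat) (U V : lmodType K) (s : 'S_n) :
  multilin n U V -> multilin n U V := multilin_reindex (perm_bij s).

End MultilinearConstructions.

(* [multihom p E] is Hom(E^{(x) p+1}, E), the maps of degree p.               *)
Definition multihom (p : nat) (K : fieldType) (E : lmodType K) := multilin p.+1 E E.

Section Balavoine.
Variables (K : fieldType) (E : lmodType K).

(* An (a, b)-shuffle of the positions 0, ..., a + b - 1, extended by the      *)
(* identity to all n positions (which leaves its sign unchanged).             *)
Definition is_shuffle (n a b : nat) (s : 'S_n) : bool :=
  [forall i : 'I_n, forall j : 'I_n, ((i < j < a) || (a <= i < j) && (j < a + b))%N ==>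
     (s i < s j)%N]
  && [forall i : 'I_n, (a + b <= i)%N ==> (s i == i)].

(* Positions are counted from 0, so k ranges over 0, ..., p and replaces the  *)
(* usual k - 1 in the shuffle type (k - 1, q) and in the sign (-1)^((k-1)q).  *)
(* The argument y of insert_args is x \o s for a (k, q)-shuffle s; as s fixes *)
(* the positions from k + q on, y and x agree there.                          *)
Definition insert_args (p q : nat) (k : 'I_p.+1) (Q : ('I_q.+1 -> E) -> E)
    (y : 'I_(p + q).+1 -> E) : 'I_p.+1 -> E :=
  fun i => if (i < k)%N then y (inord i)
           else if i == k then Q (fun j => y (inord (k + j)))
           else y (inord (i + q)).

Lemma insert_args_update (p q : nat) (k : 'I_p.+1) (Q : multihom q E)
  (y : 'I_(p + q).+1 -> E) (j : 'I_(p + q).+1) :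
  (exists i : 'I_p.+1, forall u,
     insert_args k Q (dfwith y (i := j) u) =
     dfwith (insert_args k Q y) (i := i) u) \/
  (exists l : 'I_q.+1, forall u,
     insert_args k Q (dfwith y (i := j) u) =
     dfwith (insert_args k Q y) (i := k)
       (Q (dfwith (fun l' : 'I_q.+1 => y (inord (k + l'))) (i := l) u))).
Proof.
have [jk|kj] := ltnP j k.
- left; exists (inord j) => u; apply/funext => i.
  have jp : (j < p.+1)%N by apply: ltn_trans jk _.
  case: (eqVneq (inord j) i) => [<-|ij].
  + rewrite dfwith_in /insert_args inordK // jk inord_val dfwith_in //.
  + have nij : (j == i :> nat) = false.
      by apply: contraNF ij => /eqP ->; rewrite inord_val.
    rewrite dfwith_out // /insert_args.
    have ipq : (i < (p + q).+1)%N by rewrite (leq_trans (ltn_ord i)) // ltnS leq_addr.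
    have ipq' : (i + q < (p + q).+1)%N by rewrite ltnS leq_add2r -ltnS.
    case: ltnP => ik.
      by rewrite dfwith_out // -val_eqE /= inordK // nij.
    case: eqP => [_|_].
      congr (Q _); apply/funext => l; rewrite dfwith_out // -val_eqE /= inordK.
        by apply/eqP; lia.
      have := ltn_ord k; have := ltn_ord l; lia.
    rewrite dfwith_out // -val_eqE /= inordK //; apply/eqP; lia.
- have [jkq|kqj] := leqP j (k + q).
  + right; exists (inord (j - k)) => u.
    have jkl : (j - k < q.+1)%N by lia.
    apply/funext => i; case: (eqVneq k i) => [<-|ki].
      rewrite dfwith_in /insert_args ltnn eqxx; congr (Q _); apply/funext => l.
      case: (eqVneq (inord (j - k)) l) => [<-|jl].
        have -> : inord (k + (inord (j - k) : 'I_q.+1)) = j :> 'I_(p + q).+1.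
          by apply/val_inj; rewrite /= (inordK jkl) subnKC // inordK.
        by rewrite !dfwith_in.
      have nl : (j - k == l)%N = false.
        by apply: contraNF jl => /eqP ->; rewrite inord_val.
      rewrite !dfwith_out // -val_eqE /= inordK; first by move: nl; lia.
      have := ltn_ord k; have := ltn_ord l; lia.
    rewrite dfwith_out // /insert_args eq_sym (negPf ki).
    have := ltn_ord i; have := ltn_ord k => kp ip.
    move: ki; rewrite -val_eqE /= => ki.
    case: ltnP => ik; rewrite dfwith_out // -val_eqE /= inordK; lia.
  + left; exists (inord (j - q)) => u.
    have jp := ltn_ord j.
    have jqp : (j - q < p.+1)%N by lia.
    apply/funext => i; case: (eqVneq (inord (j - q)) i) => [<-|ij].
      rewrite dfwith_in /insert_args -val_eqE /= inordK //.
      rewrite ifF; last by lia.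
      rewrite ifF; last by lia.
      have -> : inord (j - q + q) = j :> 'I_(p + q).+1.
        by apply/val_inj; rewrite /= inordK; lia.
      by rewrite dfwith_in.
    have nij : (j - q == i)%N = false.
      by apply: contraNF ij => /eqP ->; rewrite inord_val.
    have := ltn_ord i; have := ltn_ord k => kp ip.
    rewrite dfwith_out // /insert_args.
    case: ltnP => ik.
      by rewrite dfwith_out // -val_eqE /= inordK; lia.
    case: eqP => [_|ki].
      congr (Q _); apply/funext => l; have := ltn_ord l => lq.
      by rewrite dfwith_out // -val_eqE /= inordK; lia.
    by rewrite dfwith_out // -val_eqE /= inordK; lia.
Qed.

Lemma insertion_subproof (p q : nat) (k : 'I_p.+1) (P : multihom p E) (Q : multihom q E) :
  multilinear (fun y => P (insert_args k Q y)).
Proof.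
move=> y j a u v; case: (insert_args_update k Q y j) => -[i Ei]; rewrite !Ei.
  exact: multilinP.
by rewrite (multilinP Q) (multilinP P).
Qed.

Definition insertion (p q : nat) (k : 'I_p.+1) (P : multihom p E) (Q : multihom q E) :
  multihom (p + q) E := to_multilin (insertion_subproof k P Q).

Definition diamond_at (p q : nat) (k : 'I_p.+1) (P : multihom p E) (Q : multihom q E) :
    multihom (p + q) E :=
  \sum_(s : 'S_(p + q).+1 | is_shuffle k q s)
     (-1) ^+ s *: multilin_perm s (insertion k P Q).

Definition diamond (p q : nat) (P : multihom p E) (Q : multihom q E) :
    multihom (p + q) E :=
  \sum_(k < p.+1) (-1) ^+ (k * q) *: diamond_at k P Q.

Definition balavoine (p q : nat) (P : multihom p E) (Q : multihom q E) :
    multihom (p + q) E :=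
  diamond P Q -
  (-1) ^+ (p * q) *: multilin_cast (congr1 succn (addnC q p)) (diamond Q P).

End Balavoine.

Section DgLa.
Variables (K : fieldType) (g h : leibnizType K).
Variable rho : leibniz_representation g h.
Local Notation E := (g * h)%type.

(* [cochain p] is C^{p+1}(g, h), of degree p + 1 in the dgLa; degrees start   *)
(* at 1. The sign (-1)^(m-1) for m = p + 1 is (-1)^p.                         *)
Definition cochain (p : nat) := multilin p.+1 g h.

Lemma cochain_ext_subproof (p : nat) (f : cochain p) :
  multilinear (fun x : 'I_p.+1 -> E => (0, f (fst \o x)) : E).
Proof.
move=> x i a u v.
have D w : fst \o dfwith x (i := i) w = dfwith (fst \o x) (i := i) w.1.
  apply/funext => j /=; case: (eqVneq i j) => [<-|ij]; first by rewrite !dfwith_in.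
  by rewrite !dfwith_out.
rewrite !D /= multilinP; congr pair; by rewrite /= scaler0 addr0.
Qed.

(* Extension by zero to E = g (+) h: a tuple with an entry in h is sent to 0. *)
Definition cochain_ext (p : nat) (f : cochain p) : multihom p E :=
  to_multilin (cochain_ext_subproof f).

Lemma cochain_res_subproof (p : nat) (F : multihom p E) :
  multilinear (fun x : 'I_p.+1 -> g => (F (fun i => (x i, 0))).2).
Proof.
move=> x i a u v.
have D w : (fun j => (dfwith x (i := i) w j, 0) : E) =
           dfwith (fun j => (x j, 0) : E) (i := i) (w, 0).
  apply/funext => j /=; case: (eqVneq i j) => [<-|ij]; first by rewrite !dfwith_in.
  by rewrite !dfwith_out.
rewrite !D; have -> : (a *: u + v, 0) = a *: (u, 0) + (v, 0) :> E.
  by congr pair; rewrite /= scaler0 addr0.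
by rewrite multilinP.
Qed.

Definition cochain_res (p : nat) (F : multihom p E) : cochain p :=
  to_multilin (cochain_res_subproof F).

Definition mu_g (u v : E) : E := (lbracket u.1 v.1, 0).
Definition mu_h (u v : E) : E := (0, lbracket u.2 v.2).
Definition rhoLR (u v : E) : E := (0, rhoL rho u.1 v.2 + rhoR rho v.1 u.2).

Lemma mu_g_bilinear : bilinear_for *:%R *:%R mu_g.
Proof.
by split=> u a v w; congr pair; rewrite /= ?linearPl ?linearPr ?scaler0 ?addr0.
Qed.

Lemma mu_h_bilinear : bilinear_for *:%R *:%R mu_h.
Proof.
by split=> u a v w; congr pair; rewrite /= ?linearPl ?linearPr ?scaler0 ?addr0.
Qed.

Lemma rhoLR_bilinear : bilinear_for *:%R *:%R rhoLR.
Proof.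
by split=> u a v w; congr pair;
  rewrite /= ?linearPl ?linearPr ?scaler0 ?addr0 // scalerDr addrACA.
Qed.

HB.instance Definition _ :=
  bilinear_isBilinear.Build K E E E *:%R *:%R mu_g mu_g_bilinear.
HB.instance Definition _ :=
  bilinear_isBilinear.Build K E E E *:%R *:%R mu_h mu_h_bilinear.
HB.instance Definition _ :=
  bilinear_isBilinear.Build K E E E *:%R *:%R rhoLR rhoLR_bilinear.

Definition Mu_g : multihom 1 E := multilin_bilin mu_g.
Definition Mu_h : multihom 1 E := multilin_bilin mu_h.
Definition RhoLR : multihom 1 E := multilin_bilin rhoLR.

(* cochain_res only keeps the component in Hom(g^{(x) n}, h) of a map on E;   *)
(* dgla_diffE and dgla_bracketE below show that there is no other component.  *)
Definition dgla_diff (p : nat) (f : cochain p) : cochain p.+1 :=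
  cochain_res (balavoine (Mu_g + RhoLR) (cochain_ext f)).

Definition dgla_bracket (p q : nat) (f : cochain p) (f' : cochain q) :
    cochain (p + q).+1 :=
  cochain_res
    ((-1) ^+ p *: balavoine (balavoine Mu_h (cochain_ext f)) (cochain_ext f')).

Definition maurer_cartan (f : cochain 0) : Prop :=
  dgla_diff f + 2^-1 *: dgla_bracket f f = 0.

Definition proj_g (u : E) : E := (u.1, 0).

Lemma cochain_resK (p : nat) (F : multihom p E) :
    (forall x, (F x).1 = 0) -> (forall x, F (proj_g \o x) = F x) ->
  cochain_ext (cochain_res F) = F.
Proof.
move=> F1 Fp; apply/val_inj/funext => x /=.
by rewrite [RHS]surjective_pairing F1 -[in RHS]Fp.
Qed.

Lemma diamondE (p q : nat) (P : multihom p E) (Q : multihom q E) x :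
  diamond P Q x = \sum_(k < p.+1) (-1) ^+ (k * q) *:
    \sum_(s : 'S_(p + q).+1 | is_shuffle k q s)
       (-1) ^+ s *: P (insert_args k Q (x \o s)).
Proof.
rewrite /diamond multilin_sumE; apply: eq_bigr => k _ /=.
rewrite -[LHS]/(_ *: (diamond_at _ _ _ x)); congr (_ *: _).
by rewrite /diamond_at multilin_sumE.
Qed.

Lemma balavoineE (p q : nat) (P : multihom p E) (Q : multihom q E) x :
  balavoine P Q x = diamond P Q x - (-1) ^+ (p * q) *:
    diamond Q P (x \o cast_ord (congr1 succn (addnC q p))).
Proof. reflexivity. Qed.

Definition proj_except (n : nat) (k : 'I_n) (y : 'I_n -> E) : 'I_n -> E :=
  fun i => if i == k then y i else proj_g (y i).

Lemma fst_proj_except (n : nat) (k : 'I_n) (y : 'I_n -> E) i :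
  (proj_except k y i).1 = (y i).1.
Proof. by rewrite /proj_except; case: eqP. Qed.

Lemma cochain_ext_fst (p : nat) (f : cochain p) (y z : 'I_p.+1 -> E) :
  (forall i, (y i).1 = (z i).1) -> cochain_ext f y = cochain_ext f z.
Proof. by move=> yz /=; congr (_, f _); apply/funext. Qed.

Lemma cochain_ext_eq0 (p : nat) (f : cochain p) (y : 'I_p.+1 -> E) i :
  (y i).1 = 0 -> cochain_ext f y = 0.
Proof. by move=> yi /=; rewrite (@multilin_eq0 K _ g h f (fst \o y) i). Qed.

Lemma insert_args_proj (p q : nat) (k : 'I_p.+1) (Q : multihom q E)
    (z : 'I_(p + q).+1 -> E) :
  (forall w, Q (proj_g \o w) = Q w) ->
  insert_args k Q (proj_g \o z) = proj_except k (insert_args k Q z).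
Proof.
move=> Qp; apply/funext => i; rewrite /proj_except /insert_args.
case: (eqVneq i k) => [->|ik]; first by rewrite ltnn -[RHS]Qp.
by case: ltnP.
Qed.

Lemma insert_args_at (p q : nat) (k : 'I_p.+1) (Q : multihom q E)
    (z : 'I_(p + q).+1 -> E) :
  insert_args k Q z k = Q (fun j => z (inord (k + j))).
Proof. by rewrite /insert_args ltnn eqxx. Qed.

Lemma diamond_fst0 (p q : nat) (P : multihom p E) (Q : multihom q E) x :
  (forall k z, (P (insert_args k Q z)).1 = 0) -> (diamond P Q x).1 = 0.
Proof.
move=> P0; rewrite diamondE raddf_sum big1 // => k _.
rewrite /= raddf_sum big1 ?scaler0 // => s _.
by rewrite /= P0 scaler0.
Qed.

Lemma diamond_eq0 (p q : nat) (P : multihom p E) (Q : multihom q E) :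
  (forall k z, P (insert_args k Q z) = 0) -> diamond P Q = 0.
Proof.
move=> P0; apply/val_inj/funext => x; rewrite -[LHS]/(diamond P Q x) diamondE.
rewrite big1 // => k _; rewrite big1 ?scaler0 // => s _.
by rewrite P0 scaler0.
Qed.

Lemma diamond_proj (p q : nat) (P : multihom p E) (Q : multihom q E) x :
    (forall k z, P (insert_args k Q (proj_g \o z)) = P (insert_args k Q z)) ->
  diamond P Q (proj_g \o x) = diamond P Q x.
Proof.
move=> PQ; rewrite !diamondE; apply: eq_bigr => k _; congr (_ *: _).
by apply: eq_bigr => s _; rewrite -[in RHS]PQ.
Qed.

Lemma ord2P (k : 'I_2) : k = ord0 \/ k = ord_max.
Proof.
by case: k => [[|[|]]] // i; [left|right]; apply/val_inj.
Qed.

Lemma dgla_diffE (p : nat) (f : cochain p) :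
  cochain_ext (dgla_diff f) = balavoine (Mu_g + RhoLR) (cochain_ext f).
Proof.
set M := Mu_g + RhoLR; set F := cochain_ext f.
have ME (y : 'I_2 -> E) : M y = (lbracket (y ord0).1 (y ord_max).1,
    rhoL rho (y ord0).1 (y ord_max).2 + rhoR rho (y ord_max).1 (y ord0).2).
  by congr pair; rewrite /= ?addr0 ?add0r.
have Fp w : F (proj_g \o w) = F w by exact: cochain_ext_fst.
have MF1 k z : (M (insert_args k F z)).1 = 0.
  have Fk : (insert_args k F z k).1 = 0 by rewrite insert_args_at.
  rewrite ME -[LHS]/(lbracket _ _).
  by case: (ord2P k) Fk => -> ->; rewrite ?linear0l ?linear0r.
have MFp k z : M (insert_args k F (proj_g \o z)) = M (insert_args k F z).
  have Fk : (insert_args k F z k).1 = 0 by rewrite insert_args_at.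
  rewrite insert_args_proj // !ME !fst_proj_except; congr pair.
  case: (ord2P k) Fk => -> Fk; rewrite Fk !linear0l /proj_except.
    by rewrite eqxx.
  by rewrite eqxx.
have FMp k z : F (insert_args k M (proj_g \o z)) = F (insert_args k M z).
  apply: cochain_ext_fst => i; rewrite /insert_args.
  case: ifP => // _; case: ifP => // _.
apply: cochain_resK => x; rewrite !balavoineE.
  by rewrite /= diamond_fst0 // diamond_fst0 // scaler0 subr0.
by rewrite diamond_proj // -compA diamond_proj.
Qed.

Lemma dgla_bracketE (p q : nat) (f : cochain p) (f' : cochain q) :
  cochain_ext (dgla_bracket f f') =
  (-1) ^+ p *: balavoine (balavoine Mu_h (cochain_ext f)) (cochain_ext f').
Proof.
set F := cochain_ext f; set G := cochain_ext f'.
have FM : diamond F Mu_h = 0.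
  apply: diamond_eq0 => k z; apply: (@cochain_ext_eq0 _ _ _ k).
  by rewrite insert_args_at.
set B := balavoine Mu_h F.
have BE : B = diamond Mu_h F.
  by apply/val_inj/funext => x; rewrite /= FM /= scaler0 subr0.
have B1 y : (B y).1 = 0 by rewrite BE diamond_fst0.
have MhE (y : 'I_2 -> E) : Mu_h y = mu_h (y ord0) (y ord_max) by [].
have BP (i : 'I_(1 + p).+1) z : (z i).1 = 0 -> B (proj_except i z) = B z.
  move=> zi; rewrite BE !diamondE; apply: eq_bigr => k _; congr (_ *: _).
  apply: eq_bigr => s _; congr (_ *: _).
  have -> : proj_except i z \o s = proj_except ((s^-1)%g i) (z \o s).
    apply/funext => j; rewrite /proj_except /=.
    by rewrite -[j == _](inj_eq (@perm_inj _ s)) permKV.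
  have {zi} : ((z \o s) ((s^-1)%g i)).1 = 0 by rewrite /= permKV.
  move: (z \o s) ((s^-1)%g i) => y j yj0.
  have I00 (w : 'I_(1 + p).+1 -> E) : insert_args ord0 F w ord0 = F (fun l => w (inord l)).
    by rewrite insert_args_at.
  have I01 (w : 'I_(1 + p).+1 -> E) : insert_args ord0 F w ord_max = w (inord (1 + p)) by [].
  have I10 (w : 'I_(1 + p).+1 -> E) : insert_args ord_max F w ord0 = w (inord 0) by [].
  have I11 (w : 'I_(1 + p).+1 -> E) : insert_args ord_max F w ord_max =
    F (fun l => w (inord (1 + l))) by rewrite insert_args_at.
  have Fe (e : 'I_p.+1 -> 'I_(1 + p).+1) :
      F (fun l => proj_except j y (e l)) = F (fun l => y (e l)).
    by apply: cochain_ext_fst => l; rewrite fst_proj_except.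
  rewrite !MhE /mu_h; congr (_, _); have jp := ltn_ord j.
  case: (ord2P k) => ->.
    rewrite !I00 !I01 Fe; case: (eqVneq j (inord (1 + p))) => [jE|jN].
      by rewrite /proj_except -jE eqxx.
    have jlt : (j < p.+1)%N.
      have : ((j : nat) != 1 + p)%N by apply: contra jN => /eqP E; apply/eqP/val_inj; rewrite /= inordK.
      lia.
    rewrite (@cochain_ext_eq0 _ _ _ (inord j)) ?linear0l //.
    by rewrite inordK // inord_val.
  rewrite !I10 !I11 Fe; case: (eqVneq j (inord 0)) => [jE|jN].
    by rewrite /proj_except -jE eqxx.
  have jgt : (0 < j)%N.
    have : ((j : nat) != 0)%N by apply: contra jN => /eqP E; apply/eqP/val_inj; rewrite /= inordK.
    lia.
  rewrite (@cochain_ext_eq0 _ _ _ (inord j.-1)) ?linear0r //.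
  have jlt : (j.-1 < p.+1)%N by lia.
  rewrite inordK //; suff -> : inord (1 + j.-1) = j by [].
  by apply/val_inj; rewrite /= inordK; lia.
have BGp k z : B (insert_args k G (proj_g \o z)) = B (insert_args k G z).
  have Gp w : G (proj_g \o w) = G w by exact: cochain_ext_fst.
  by rewrite insert_args_proj // BP // insert_args_at.
have GB : diamond G B = 0.
  apply: diamond_eq0 => k z; apply: (@cochain_ext_eq0 _ _ _ k).
  by rewrite insert_args_at.
have BGE : balavoine B G = diamond B G.
  by apply/val_inj/funext => x; rewrite /= GB /= scaler0 subr0.
apply: cochain_resK => x.
  by rewrite BGE /= diamond_fst0 ?scaler0.
by rewrite BGE !multilinZE diamond_proj.
Qed.

End DgLa.

(* Main.v *)
(* In the lowest degrees the only shuffle is the identity, so every Balavoine *)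
(* bracket is a signed sum of plain compositions. One finds                   *)
(* (dH)(x, y) = rhoL x (H y) + rhoR y (H x) - H [x, y], while the bracket of  *)
(* H with itself is 2 [H x, H y]; halving it needs characteristic not 2.      *)

Require Import Defs.
From mathcomp Require Import all_boot all_algebra.
From mathcomp Require Import all_fingroup sesquilinear boolp functions.

Set Implicit Arguments.
Unset Strict Implicit.
Unset Printing Implicit Defensive.

Import GRing.Theory.
Local Open Scope ring_scope.

(** Evaluated at a pair [(x, y)], the Maurer-Cartan expression of [H] is exactly the defect of the
    crossed homomorphism identity, so the two conditions are the same equation. The part linear in
    [H] is [dgla_diff_linear], the quadratic part [dgla_bracket_linear]; both follow from
    [balavoine10E]. *)

Lemma is_shuffle_le1 (n a b : nat) (s : 'S_n) :
  (a + b <= 1)%N -> is_shuffle a b s = (s == 1%g).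
Proof.
move=> ab1; apply/idP/eqP => [/andP[_ /forallP sfix]|->]; last first.
  apply/andP; split; last by apply/forallP => i; rewrite perm1 eqxx implybT.
  apply/forallP => i; apply/forallP => j; apply/implyP; rewrite !perm1.
  by case/orP => /andP[] => [->|/andP[_ ->]].
have fix_gt0 (i : 'I_n) : (0 < i)%N -> s i = i.
  by move=> i0; apply/eqP/(implyP (sfix i))/(leq_trans ab1).
apply/permP => i; rewrite perm1.
have [i0|/fix_gt0//] := posnP i.
(* If [s] moved 0 to a positive position, that position would be fixed, contradicting
   injectivity. *)
have [si0|/fix_gt0/perm_inj//] := posnP (s i).
by apply/val_inj; rewrite /= i0 si0.
Qed.

Section MaurerCartan.
Variables (K : fieldType) (g h : leibnizType K).
Local Notation E := (g * h)%type.

Lemma diamond10E (P : multihom 1 E) (Q : multihom 0 E) (x : 'I_2 -> E) :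
  diamond P Q x =
  P (insert_args (ord0 : 'I_2) Q x) + P (insert_args (ord_max : 'I_2) Q x).
Proof.
have x1 : x \o (1%g : 'S_2) = x by apply/funext => i /=; rewrite perm1.
rewrite diamondE big_ord_recl big_ord1 !muln0 !expr0 !scale1r.
have -> : lift ord0 ord0 = ord_max :> 'I_2 by apply/val_inj.
by congr (_ + _); under eq_bigl do rewrite is_shuffle_le1 //;
  rewrite big_pred1_eq odd_perm1 expr0 scale1r x1.
Qed.

Lemma diamond01E (P : multihom 0 E) (Q : multihom 1 E) (x : 'I_2 -> E) :
  diamond P Q x = P (insert_args (ord0 : 'I_1) Q x).
Proof.
have x1 : x \o (1%g : 'S_2) = x by apply/funext => i /=; rewrite perm1.
rewrite diamondE big_ord1 mul0n expr0 scale1r.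
under eq_bigl do rewrite is_shuffle_le1 //.
by rewrite big_pred1_eq odd_perm1 expr0 scale1r x1.
Qed.

(** Here every sign is [+1], and the bracket measures how far the linear map [Q] is from being a
    derivation of the product [P]. *)
Lemma balavoine10E (P : multihom 1 E) (Q : multihom 0 E) (x : 'I_2 -> E) :
  balavoine P Q x =
  P (insert_args (ord0 : 'I_2) Q x) + P (insert_args (ord_max : 'I_2) Q x) -
  Q (insert_args (ord0 : 'I_1) P x).
Proof.
rewrite balavoineE muln0 expr0 scale1r diamond10E diamond01E.
by congr (_ - Q (insert_args _ _ _)); apply/funext => i; congr x; apply/val_inj.
Qed.

Variables (rho : leibniz_representation g h) (H : {linear g -> h}).
Local Notation F := (cochain_ext (multilin_lin H)).

Lemma insert_linear0 (x : 'I_2 -> E) :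
  (insert_args (ord0 : 'I_2) F x ord0 = (0, H (x ord0).1)) *
  (insert_args (ord0 : 'I_2) F x ord_max = x ord_max).
Proof.
split; last by congr x; apply/val_inj; rewrite /= inordK.
by rewrite insert_args_at /=; congr (_, H (x _).1);
  apply/val_inj; rewrite /= inordK.
Qed.

Lemma insert_linear1 (x : 'I_2 -> E) :
  (insert_args (ord_max : 'I_2) F x ord0 = x ord0) *
  (insert_args (ord_max : 'I_2) F x ord_max = (0, H (x ord_max).1)).
Proof.
split; first by congr x; apply/val_inj; rewrite /= inordK.
by rewrite insert_args_at /=; congr (_, H (x _).1);
  apply/val_inj; rewrite /= inordK.
Qed.

Lemma multilin_bilinE (U V : lmodType K) (b : {bilinear U -> U -> V})
    (y : 'I_2 -> U) :
  multilin_bilin b y = b (y ord0) (y ord_max).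
Proof. by []. Qed.

Lemma cochain_ext_linearE (y : 'I_1 -> E) : F y = (0, H (y ord0).1).
Proof. by []. Qed.

Lemma dgla_diff_linear (x : 'I_2 -> g) :
  dgla_diff rho (multilin_lin H) x =
  rhoL rho (x ord0) (H (x ord_max)) + rhoR rho (x ord_max) (H (x ord0))
  - H (lbracket (x ord0) (x ord_max)).
Proof.
rewrite -[LHS]/(balavoine (Mu_g g h + RhoLR rho) F (fun i => (x i, 0))).2.
rewrite balavoine10E !multilinDE !multilin_bilinE.
rewrite !insert_linear0 !insert_linear1.
rewrite cochain_ext_linearE insert_args_at multilinDE !multilin_bilinE /=.
have -> : inord ((ord0 : 'I_1) + (ord0 : 'I_2))%N = ord0 :> 'I_2.
  by apply: val_inj; rewrite /= inordK.
have -> : inord ((ord0 : 'I_1) + (ord_max : 'I_2))%N = ord_max :> 'I_2.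
  by apply: val_inj; rewrite /= inordK.
by rewrite !linear0l !add0r !addr0 [rhoR _ _ _ + _]addrC.
Qed.

(** The term [F] after [Mu_h] vanishes, since [Mu_h] lands in [h] and [F] reads only the
    [g]-component. General arguments of [E] are kept because the next bracket feeds in values of
    [F], which lie in [h]. *)
Lemma balavoine_Mu_h_linear (y : 'I_2 -> E) :
  balavoine (Mu_h g h) F y =
  (0, lbracket (H (y ord0).1) (y ord_max).2 +
      lbracket (y ord0).2 (H (y ord_max).1)).
Proof.
rewrite balavoine10E !multilin_bilinE !insert_linear0 !insert_linear1.
rewrite cochain_ext_linearE insert_args_at multilin_bilinE.
by congr (_, _); rewrite /= ?linear0 ?addr0 ?subr0.
Qed.

(** Inserting [F] in either slot of [balavoine (Mu_h g h) F] yields the same term, whence the factor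
    2. *)
Lemma dgla_bracket_linear (x : 'I_2 -> g) :
  dgla_bracket (multilin_lin H) (multilin_lin H) x =
  lbracket (H (x ord0)) (H (x ord_max)) *+ 2.
Proof.
rewrite -[LHS]/((1 *: balavoine (balavoine (Mu_h g h) F) F)
                  (fun i : 'I_2 => (x i, 0))).2.
rewrite scale1r balavoine10E !balavoine_Mu_h_linear.
rewrite !insert_linear0 !insert_linear1.
rewrite cochain_ext_linearE insert_args_at balavoine_Mu_h_linear /=.
by rewrite !linear0 add0r !addr0.
Qed.

End MaurerCartan.

Theorem proposition3p1 (K : fieldType) (charK0 : [pchar K] =i pred0)
  (g h : leibnizType K) (rho : leibniz_representation g h)
  (H : {linear g -> h}) :
  crossed_homomorphism rho H <-> maurer_cartan rho (multilin_lin H).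
Proof.
have two0 : 2 != 0 :> K by have /pcharf0P -> := charK0.
have mcE (x : 'I_2 -> g) :
    (dgla_diff rho (multilin_lin H) +
      2^-1 *: dgla_bracket (multilin_lin H) (multilin_lin H)) x =
    rhoL rho (x ord0) (H (x ord_max)) + rhoR rho (x ord_max) (H (x ord0))
    + lbracket (H (x ord0)) (H (x ord_max)) - H (lbracket (x ord0) (x ord_max)).
  rewrite multilinDE multilinZE dgla_diff_linear dgla_bracket_linear.
  by rewrite -scaler_nat scalerA mulVf // scale1r addrAC.
split=> [Hx|mc x y].
  by apply/val_inj/funext => x; rewrite [LHS]mcE Hx subrr.
(* The pair [(x, y)] as a tuple indexed by ['I_2]. *)
have := mcE (fun i => if i == ord0 then x else y).
by rewrite [_ + _]mc /= => /esym/eqP; rewrite subr_eq0 => /eqP.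
Qed.
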